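(* Let $\mathcal{A}$ and $\mathcal{B}$ be two undirected weighted graphs on the common vertex set $\{1,\dots,n\}$ with real symmetric adjacency matrices $A,B\in\mathbb{R}^{n\times n}$. Assume that $\mathcal{A}$ and $\mathcal{B}$ are both friendly and that they are isomorphic. Then GM and RGM are equivalent, i.e., the set of permutation matrices obtained by taking the minimizers of the relaxed problem $$\min_{P\in\mathcal{D}} \|PA-BP\|_F^2$$ and projecting them onto the permutation matrices via $\hat\Pi=\arg\max_{\Pi\in\mathcal{P}}\mathrm{tr}(\Pi^T P)$ coincides with $\mathrm{Iso}(\mathcal{A}\mapsto\mathcal{B})$.
   Context: $\mathcal{P}$ denotes the set of $n\times n$ permutation matrices and $\mathcal{D}=\{P\in\mathbb{R}^{n\times n}: P\ge 0 \text{ entrywise},\ P\mathbf{1}=P^T\mathbf{1}=\mathbf{1}\}$ the set of doubly-stochastic matrices, where $\mathbf{1}$ is the all-ones vector. The distortion of $\Pi\in\mathcal{P}$ is $\mathrm{dis}(\Pi)=\|A-\Pi^T B\Pi\|_F=\|\Pi A-B\Pi\|_F$; the graphs are isomorphic if some $\Pi\in\mathcal{P}$ has $\mathrm{dis}(\Pi)=0$, and $\mathrm{Iso}(\mathcal{A}\mapsto\mathcal{B})=\{\Pi\in\mathcal{P}:\mathrm{dis}(\Pi)=0\}$. GM (graph matching) is the problem of minimizing $\mathrm{dis}(\Pi)$ over $\Pi\in\mathcal{P}$; RGM (relaxed graph matching) is the two-step procedure: solve $\min_{P\in\mathcal{D}}\|PA-BP\|_F^2$, then project the solution onto $\mathcal{P}$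 by solving the linear assignment problem $\arg\max_{\Pi\in\mathcal{P}}\mathrm{tr}(\Pi^T P)$. A graph with symmetric adjacency matrix $A=U\Lambda U^T$ ($U=(u_1,\dots,u_n)$ orthonormal eigenvectors, $\Lambda=\mathrm{diag}(\lambda_1,\dots,\lambda_n)$) is called friendly if all eigenvalues $\lambda_i$ are distinct and every eigenvector satisfies $u_i^T\mathbf{1}\neq 0$. *)

(* Defs.v *)
From mathcomp Require Import all_boot all_order all_algebra.
From mathcomp Require Import mathcomp_extra boolp classical_sets reals.

Set Implicit Arguments.
Unset Strict Implicit.
Unset Printing Implicit Defensive.

Import Order.TTheory GRing.Theory Num.Theory.

Local Open Scope ring_scope.
Local Open Scope classical_set_scope.

Definition argmin_on (R : realType) (T : Type) (D : set T) (f : T -> R) :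
  set T := [set x | D x /\ forall y, D y -> f x <= f y].

Definition argmax_on (R : realType) (T : Type) (D : set T) (f : T -> R) :
  set T := [set x | D x /\ forall y, D y -> f y <= f x].

Section GraphMatching.
Variables (R : realType) (n : nat).
Implicit Types A B P Q U : 'M[R]_n.

Definition frobenius_norm A : R := Num.sqrt (\sum_i \sum_j A i j ^+ 2).

Definition ones : 'cV[R]_n := const_mx 1.

Definition permutation_matrices : set 'M[R]_n :=
  [set Q : 'M[R]_n | is_perm_mx Q].

Definition doubly_stochastic : set 'M[R]_n :=
  [set P : 'M[R]_n | [/\ (forall i j, 0 <= P i j), P *m ones = ones
                      & P^T *m ones = ones]].

Definition dis A B Q : R := frobenius_norm (A - Q^T *m B *m Q).

Definition Iso A B : set 'M[R]_n :=
  [set Q | permutation_matrices Q /\ dis A B Q = 0].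

Definition isomorphic A B : Prop := exists Q, Iso A B Q.

(* The columns of [U] are orthonormal eigenvectors of [A], with eigenvalues the
   entries of [lam]. *)
Definition eigendecomposition A U (lam : 'rV[R]_n) : Prop :=
  U^T *m U = 1%:M /\ A = U *m diag_mx lam *m U^T.

(* Every real symmetric matrix has an eigendecomposition; when the eigenvalues
   are distinct it is unique up to reordering and signs of the columns of [U],
   so the choice of the decomposition is irrelevant. *)
Definition friendly A : Prop :=
  exists U lam,
    [/\ eigendecomposition A U lam,
        (forall i j, i != j -> lam 0 i != lam 0 j) &
        (forall i, ((col i U)^T *m ones) 0 0 != 0)].

Definition GM A B : set 'M[R]_n := argmin_on permutation_matrices (dis A B).

Definition relaxed_minimizers A B : set 'M[R]_n :=
  argmin_on doubly_stochastic (fun P => frobenius_norm (P *m A - B *m P) ^+ 2).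

(* Linear assignment may have several optimal solutions: all are kept. *)
Definition projections P : set 'M[R]_n :=
  argmax_on permutation_matrices (fun Q => \tr (Q^T *m P)).

Definition RGM A B : set 'M[R]_n :=
  [set Q | exists2 P, relaxed_minimizers A B P & projections P Q].

End GraphMatching.

(* Main.v *)
Require Import Defs.
From mathcomp Require Import all_boot all_order all_fingroup all_algebra.
From mathcomp Require Import mathcomp_extra boolp classical_sets reals.

Import Order.TTheory GRing.Theory Num.Theory.

Local Open Scope ring_scope.

(** Fix an isomorphism [Q0].  A doubly stochastic [P] attains the relaxed
    minimum [0] iff [P A = B P], and then [E = Q0^T P] commutes with [A] and
    fixes the all-ones vector.  As [A] has simple spectrum, [E] is diagonal in
    the eigenbasis of [A]; as no coordinate of the all-ones vector vanishes in
    that basis, [E = 1].  Hence [Q0] is the only relaxed minimizer and the only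
    isomorphism, and it is its own unique projection. *)

Section Frobenius.
Variables (R : realType) (n : nat).
Implicit Types X Y P Q : 'M[R]_n.

Lemma sum_sqr_mx_ge0 X : 0 <= \sum_i \sum_j X i j ^+ 2.
Proof. by do 2!apply: sumr_ge0 => ? _; apply: sqr_ge0. Qed.

Lemma frobenius_norm_ge0 X : 0 <= frobenius_norm X.
Proof. exact: sqrtr_ge0. Qed.

Lemma sqr_frobenius_norm X : frobenius_norm X ^+ 2 = \tr (X^T *m X).
Proof.
rewrite sqr_sqrtr ?sum_sqr_mx_ge0// exchange_big/=; apply: eq_bigr => i _.
by rewrite mxE; apply: eq_bigr => j _; rewrite mxE expr2.
Qed.

Lemma frobenius_norm0 : frobenius_norm (0 : 'M[R]_n) = 0.
Proof. by apply/eqP; rewrite -sqrf_eq0 sqr_frobenius_norm mulmx0 mxtrace0. Qed.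

Lemma frobenius_norm_eq0 X : frobenius_norm X = 0 -> X = 0.
Proof.
move=> /(congr1 (fun x => x ^+ 2)); rewrite sqr_sqrtr ?sum_sqr_mx_ge0// expr0n.
move=> /psumr_eq0P X0; apply/matrixP => i j; rewrite mxE; apply/eqP.
rewrite -sqrf_eq0; apply/eqP.
have /psumr_eq0P -> // : \sum_j X i j ^+ 2 = 0.
  by apply: X0 => // k _; apply: sumr_ge0 => ? _; apply: sqr_ge0.
by move=> k _; apply: sqr_ge0.
Qed.

Lemma dis_ge0 A B Q : 0 <= dis A B Q :> R.
Proof. exact: frobenius_norm_ge0. Qed.

End Frobenius.

Section Permutations.
Variables (R : realType) (n : nat).
Implicit Types A B P Q : 'M[R]_n.

Lemma permutation_mulVmx Q : permutation_matrices Q -> Q^T *m Q = 1%:M.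
Proof.
by move=> /is_perm_mxP[s ->]; rewrite tr_perm_mx -perm_mxM mulVg perm_mx1.
Qed.

Lemma permutation_mulmxV Q : permutation_matrices Q -> Q *m Q^T = 1%:M.
Proof. by move=> /permutation_mulVmx; apply: mulmx1C. Qed.

Lemma permutation_doubly_stochastic Q :
  permutation_matrices Q -> doubly_stochastic Q.
Proof.
have perm1 (s : 'S_n) : perm_mx s *m ones R n = ones R n.
  by rewrite -row_permE; apply/matrixP => i j; rewrite !mxE.
move=> /is_perm_mxP[s ->]; split; rewrite ?tr_perm_mx ?perm1// => i j.
by rewrite !mxE ler0n.
Qed.

(** Multiplying by the orthogonal matrix [Q] trades the quadratic condition [A = Q^T *m B *m Q] for
    a linear one, the same equation that governs the relaxed problem. *)
Lemma dis_eq0 A B Q : permutation_matrices Q ->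
  dis A B Q = 0 <-> Q *m A = B *m Q.
Proof.
move=> permQ; split=> [/frobenius_norm_eq0/eqP|QA].
  rewrite subr_eq0 => /eqP ->.
  by rewrite !mulmxA permutation_mulmxV// mul1mx.
by rewrite /dis -mulmxA -QA mulmxA permutation_mulVmx// mul1mx subrr
  frobenius_norm0.
Qed.

(* [|Q - P|^2 = 2 n - 2 tr (Q^T P)], so maximizing the trace minimizes the
   distance. *)
Lemma projections_permutation P : permutation_matrices P ->
  projections P = [set P]%classic.
Proof.
move=> permP.
have dist Q : permutation_matrices Q ->
    frobenius_norm (Q - P) ^+ 2 = (\tr (P^T *m P) - \tr (Q^T *m P)) *+ 2.
  move=> permQ; rewrite sqr_frobenius_norm [(Q - P)^T]linearB/= mulmxBl !mulmxBr.
  rewrite !permutation_mulVmx// !linearB/= -[P^T *m Q]trmxK mxtrace_tr.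
  by rewrite trmx_mul trmxK mulr2n opprB.
apply/seteqP; split=> [Q [permQ maxQ]|_ ->].
  (* [P] competes in its own assignment problem, so optimality of [Q] makes the right-hand side of
     [dist] nonpositive. *)
  apply/eqP; rewrite -subr_eq0; apply/eqP/frobenius_norm_eq0/eqP.
  rewrite -sqrf_eq0 eq_le sqr_ge0 andbT dist// mulrn_wle0// subr_le0.
  exact: maxQ.
split=> // Q permQ.
by rewrite -subr_ge0 -(pmulrn_lge0 _ (isT : (0 < 2)%N)) -dist// sqr_ge0.
Qed.

End Permutations.

Section Friendly.
Variables (R : realType) (n : nat).
Implicit Types A B P Q E : 'M[R]_n.

Lemma friendly_commute_eq1 A E : friendly A ->
  E *m A = A *m E -> E *m ones R n = ones R n -> E = 1%:M.
Proof.
move=> [U [lam [[UU AE] lam_inj nz]]] EA E1.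
have UU' := mulmx1C UU.
(* [D] is [E] written in the eigenbasis of [A], where [A] becomes [diag_mx lam]. *)
pose D := U^T *m E *m U.
have Dlam : D *m diag_mx lam = diag_mx lam *m D.
  transitivity (U^T *m (E *m A) *m U).
    by rewrite /D AE !mulmxA -[_ *m U^T *m U]mulmxA UU mulmx1.
  by rewrite EA /D AE !mulmxA UU mul1mx.
have Doff i j : i != j -> D i j = 0.
  (* Entry [(i, j)] of the commutation relation reads [(lam_j - lam_i) * D i j = 0]. *)
  move=> ij; have /matrixP/(_ i j) := Dlam.
  rewrite mul_mx_diag mul_diag_mx !mxE mulrC => /eqP.
  rewrite -subr_eq0 -mulrBl mulf_eq0 subr_eq0 eq_sym.
  by rewrite (negbTE (lam_inj _ _ ij)) => /eqP.
pose v := U^T *m ones R n.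
have Dv : D *m v = v by rewrite /D /v mulmxA -(mulmxA _ U) UU' mulmx1 -mulmxA E1.
have v_neq0 i : v i 0 != 0.
  suff -> : v i 0 = ((col i U)^T *m ones R n) 0 0 by [].
  by rewrite !mxE; apply: eq_bigr => j _; rewrite !mxE.
have D1 : D = 1%:M.
  apply/matrixP => i j; rewrite [RHS]mxE; case: eqVneq => [<-|/Doff//].
  (* Since [D] is diagonal, row [i] of [D *m v = v] is [D i i * v i 0 = v i 0], and [v i 0] can be
     cancelled. *)
  have /matrixP/(_ i 0) := Dv; rewrite mxE (bigD1 i)//= big1 ?addr0.
    by move=> Di; apply: (mulIf (v_neq0 i)); rewrite mul1r.
  by move=> k ki; rewrite Doff ?mul0r// eq_sym.
have -> : E = U *m D *m U^T.
  by rewrite /D !mulmxA UU' mul1mx -mulmxA UU' mulmx1.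
by rewrite D1 mulmx1.
Qed.

Lemma friendly_intertwiner_eq A B P Q : friendly A ->
  permutation_matrices Q -> B^T = B -> A^T = A -> Q *m A = B *m Q ->
  doubly_stochastic P -> P *m A = B *m P -> P = Q.
Proof.
move=> frA permQ symB symA QA [_ P1 _] PA.
(* The transpose of [Q *m A = B *m Q]; with it, [Q^T *m P] commutes with [A]. *)
have QTB : Q^T *m B = A *m Q^T by rewrite -symB -trmx_mul -QA trmx_mul symA.
have QT1 : Q^T *m ones R n = ones R n.
  by have [] := permutation_doubly_stochastic _ _ _ permQ.
suff E1 : Q^T *m P = 1%:M.
  by rewrite -[P]mul1mx -(permutation_mulmxV _ _ _ permQ) -mulmxA E1 mulmx1.
apply: (friendly_commute_eq1 _ _ frA); last by rewrite -mulmxA P1.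
by rewrite -mulmxA PA !mulmxA QTB.
Qed.

(** An isomorphism is doubly stochastic with objective value 0, so the relaxed minimum is 0 and
    minimizing means making the residual vanish. *)
Lemma relaxed_minimizers_isomorphic A B : isomorphic A B ->
  relaxed_minimizers A B =
  [set P | doubly_stochastic P /\ P *m A = B *m P]%classic.
Proof.
move=> [Q [permQ /(dis_eq0 _ _ _ _ _ permQ) QA]].
apply/seteqP; split=> [P [dsP minP]|P [dsP PA]]; split=> //.
  have := minP _ (permutation_doubly_stochastic _ _ _ permQ).
  rewrite QA subrr frobenius_norm0 expr0n/= => le0.
  apply/eqP; rewrite -subr_eq0; apply/eqP/frobenius_norm_eq0/eqP.
  by rewrite -sqrf_eq0 eq_le le0 sqr_ge0.
by move=> P' _; rewrite PA subrr frobenius_norm0 expr0n sqr_ge0.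
Qed.

Lemma GM_isomorphic A B : isomorphic A B -> GM A B = Iso A B.
Proof.
move=> [Q [permQ disQ]]; apply/seteqP; split=> P [permP].
  move=> minP; split=> //; apply/eqP.
  by rewrite eq_le dis_ge0 andbT -disQ; apply: minP.
by move=> disP; split=> // P' _; rewrite disP dis_ge0.
Qed.

End Friendly.

Theorem theorem1 (R : realType) (n : nat) (A B : 'M[R]_n)
    (symA : A^T = A) (symB : B^T = B)
    (friendlyA : friendly A) (friendlyB : friendly B)
    (isoAB : isomorphic A B) :
  GM A B = RGM A B /\ RGM A B = Iso A B.
Proof.
suff RGM_Iso : RGM A B = Iso A B by rewrite RGM_Iso GM_isomorphic.
rewrite /RGM relaxed_minimizers_isomorphic//.
have [Q0 [permQ0 /(dis_eq0 _ _ _ _ _ permQ0) QA]] := isoAB.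
apply/seteqP; split=> [Q [P [dsP PA]]|Q [permQ disQ]].
  (* The relaxed minimizer [P] is forced to be [Q0], so its projection [Q] is [Q0] too. *)
  rewrite (friendly_intertwiner_eq _ _ _ _ _ _ friendlyA permQ0 symB symA QA dsP PA).
  by rewrite projections_permutation// => ->; split=> //; apply/dis_eq0.
(* An isomorphism is a relaxed minimizer that projects to itself. *)
exists Q; last by rewrite projections_permutation.
split; first exact: permutation_doubly_stochastic.
exact/dis_eq0.
Qed.
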